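(* Let $\mathcal H_{\mathrm{in}}$ be a finite-dimensional complex Hilbert space and $\mathcal M\subseteq\mathcal D(\mathcal H_{\mathrm{in}})$ a set of density operators. There exists a finite-dimensional Hilbert space $\mathcal H_{\mathrm{out}}$ and a CPTP map $\Lambda:\mathcal L(\mathcal H_{\mathrm{in}})\to\mathcal L(\mathcal H_{\mathrm{out}})$ that is purifying and reversible on $\mathcal M$ (i.e. $\operatorname{tr}(\Lambda[\rho]^2)=1$ for all $\rho\in\mathcal M$, and there is a CPTP map $\Lambda':\mathcal L(\mathcal H_{\mathrm{out}})\to\mathcal L(\mathcal H_{\mathrm{in}})$ with $(\Lambda'\circ\Lambda)[\rho]=\rho$ for all $\rho\in\mathcal M$) if and only if $\mathcal M=\bigcup_i\mathcal M_i$ where $\mathcal M_i\perp\mathcal M_j$ for $i\neq j$ and each $\mathcal M_i$ is essentially pure; that is, for each $i$ there exist finite-dimensional Hilbert spaces $\mathcal H_C^i,\mathcal H_A^i,\mathcal H_B^i$ with $\mathcal H_{\mathrm{in}}\otimes\mathcal H_C^i\cong\mathcal H_A^i\otimes\mathcal H_B^i$, density operators $\sigma_B^i\in\mathcal D(\mathcal H_B^i)$, $\omega_C^i\in\mathcal D(\mathcal H_C^i)$, and a unitary $U_i$ (from $\mathcal H_A^i\otimes\mathcal H_B^i$ to $\mathcal H_{\mathrm{in}}\otimes\mathcal H_C^i$) such that $$\{\rho\otimes\omega_C^i\mid\rho\in\mathcal M_i\}\subseteq\{U_i(|\phi\rangle\langle\phi|\otimes\sigma_B^i)U_i^\dagger\mid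 |\phi\rangle\in\mathcal H_A^i,\ \|\phi\|=1\}.$$
   Context: $\mathcal D(\mathcal H)$ denotes the set of density operators (positive semidefinite, trace one) on a finite-dimensional complex Hilbert space $\mathcal H$, and $\mathcal L(\mathcal H)$ the space of linear operators on $\mathcal H$. CPTP means completely positive and trace preserving linear map. For sets of states, $\mathcal M_i\perp\mathcal M_j$ means $\operatorname{tr}(\rho\sigma)=0$ for all $\rho\in\mathcal M_i$, $\sigma\in\mathcal M_j$. *)

(* Defs.v *)
From HB Require Import structures.
From mathcomp Require Import all_boot all_order all_algebra.
From mathcomp Require Import complex mxtens.
From mathcomp Require Import Rstruct.
From Stdlib Require Rdefinitions.
Set Implicit Arguments. Unset Strict Implicit. Unset Printing Implicit Defensive.
Import Order.TTheory GRing.Theory Num.Theory.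
Local Open Scope ring_scope.

Definition C : Type := complex Rdefinitions.R.

Definition adj {m n : nat} (A : 'M[C]_(m, n)) : 'M[C]_(n, m) :=
  (map_mx Num.conj A)^T.

Definition psd {n : nat} (A : 'M[C]_n) : Prop :=
  A = adj A /\ forall v : 'cV[C]_n, 0 <= (adj v *m A *m v) 0 0.

Definition density {n : nat} (rho : 'M[C]_n) : Prop :=
  psd rho /\ \tr rho = 1.

Definition unitary {q p : nat} (U : 'M[C]_(q, p)) : Prop :=
  U *m adj U = 1%:M /\ adj U *m U = 1%:M.

Definition linear_map {n m : nat} (f : 'M[C]_n -> 'M[C]_m) : Prop :=
  forall (a : C) (A B : 'M[C]_n), f (a *: A + B) = a *: f A + f B.

(* (id_k (x) f) applied to X in L(C^k (x) C^n); tensor index convention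
   as in [tensmx]: index (i, a) of C^k (x) C^n is i * n + a. *)
Definition ampl (k : nat) {n m : nat} (f : 'M[C]_n -> 'M[C]_m)
  (X : 'M[C]_(k * n)) : 'M[C]_(k * m) :=
  \matrix_(p, q)
    f (\matrix_(a, b) X (mxtens_index ((mxtens_unindex p).1, a))
                         (mxtens_index ((mxtens_unindex q).1, b)))
      (mxtens_unindex p).2 (mxtens_unindex q).2.

Definition completely_positive {n m : nat} (f : 'M[C]_n -> 'M[C]_m) : Prop :=
  forall (k : nat) (X : 'M[C]_(k * n)), psd X -> psd (@ampl k n m f X).

Definition trace_preserving {n m : nat} (f : 'M[C]_n -> 'M[C]_m) : Prop :=
  forall X : 'M[C]_n, \tr (f X) = \tr X.

Definition CPTP {n m : nat} (f : 'M[C]_n -> 'M[C]_m) : Prop :=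
  [/\ linear_map f, completely_positive f & trace_preserving f].

Definition purifying_on {n m : nat} (f : 'M[C]_n -> 'M[C]_m)
  (M : 'M[C]_n -> Prop) : Prop :=
  forall rho, M rho -> \tr (f rho *m f rho) = 1.

Definition reversible_on {n m : nat} (f : 'M[C]_n -> 'M[C]_m)
  (M : 'M[C]_n -> Prop) : Prop :=
  exists g : 'M[C]_m -> 'M[C]_n, CPTP g /\ forall rho, M rho -> g (f rho) = rho.

Definition orth_sets {n : nat} (M1 M2 : 'M[C]_n -> Prop) : Prop :=
  forall rho sigma, M1 rho -> M2 sigma -> \tr (rho *m sigma) = 0.

Definition essentially_pure {n : nat} (Mi : 'M[C]_n -> Prop) : Prop :=
  exists (c a b : nat) (sigB : 'M[C]_b) (omC : 'M[C]_c) (U : 'M[C]_(n * c, a * b)),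
    [/\ density sigB, density omC, unitary U &
      forall rho, Mi rho ->
        exists phi : 'cV[C]_a,
          (adj phi *m phi) 0 0 = 1 /\
          rho *t omC = U *m ((phi *m adj phi) *t sigB) *m adj U].

(* Main.v *)
(** Dilate the purifying channel to an isometry V, so that V rho V^* = psi psi^* (x) sigma for
    every rho in M (its output marginal psi psi^* being pure), and the reversing channel to an
    isometry W. Then W psi, read as a matrix A, satisfies A A^* = rho, and V A = psi (x) S with
    S S^* = sigma. For two states, z = <psi, psi'> = tr(A^* A') = tr((V A)^* V A') =
    z tr(S^* S'): either z = 0, and then rho and rho' are orthogonal, or tr(S^* S') = 1, and
    then S = S' by Cauchy-Schwarz. Hence sorting the states of M by their environment state
    sigma yields the decomposition, each class being essentially pure because V extends to a
    unitary once a pure ancilla is adjoined.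

    Conversely the unitary of an essentially pure set gives a channel producing phi phi^*, and
    one undoing it; orthogonal sets are glued by measuring the support projector of one of them
    and mapping the two outcomes to orthogonal summands. Only finitely many (at most n) of the
    sets are nonempty. *)

Require Import Defs.
From HB Require Import structures.
From mathcomp Require Import all_boot all_order all_algebra.
From mathcomp Require Import complex mxtens.
From mathcomp Require Import Rstruct.
From Stdlib Require Import Classical.
Import Order.TTheory GRing.Theory Num.Theory.
Local Open Scope ring_scope.
Set Implicit Arguments.
Unset Strict Implicit.

(** * Adjoints, the Frobenius norm and positive semidefinite matrices *)

Lemma adjE m n (A : 'M[C]_(m, n)) i j : adj A i j = Num.conj (A j i).
Proof. by rewrite !mxE. Qed.

Lemma adjK m n (A : 'M[C]_(m, n)) : adj (adj A) = A.
Proof. by apply/matrixP=> i j; rewrite !adjE conjCK. Qed.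

Lemma adjM m n p (A : 'M[C]_(m, n)) (B : 'M[C]_(n, p)) :
  adj (A *m B) = adj B *m adj A.
Proof. by rewrite /adj map_mxM trmx_mul. Qed.

Lemma isoK m n p (V : 'M[C]_(m, n)) (X : 'M[C]_(n, p)) :
  adj V *m V = 1%:M -> adj V *m (V *m X) = X.
Proof. by move=> VV; rewrite mulmxA VV mul1mx. Qed.

Lemma isoKr m n p (V : 'M[C]_(m, n)) (X : 'M[C]_(p, n)) :
  adj V *m V = 1%:M -> X *m adj V *m V = X.
Proof. by move=> VV; rewrite -mulmxA VV mulmx1. Qed.

Lemma adjD m n (A B : 'M[C]_(m, n)) : adj (A + B) = adj A + adj B.
Proof. by rewrite /adj map_mxD linearD. Qed.

Lemma adjB m n (A B : 'M[C]_(m, n)) : adj (A - B) = adj A - adj B.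
Proof. by rewrite /adj map_mxB linearB. Qed.

Lemma adj_scale m n (c : C) (A : 'M[C]_(m, n)) : adj (c *: A) = Num.conj c *: adj A.
Proof. by apply/matrixP=> i j; rewrite !mxE rmorphM. Qed.

Lemma adj_1 n : adj (1%:M : 'M[C]_n) = 1%:M.
Proof. by rewrite /adj map_mx1 trmx1. Qed.

Lemma adj0 m n : adj (0 : 'M[C]_(m, n)) = 0.
Proof. by rewrite /adj map_mx0 trmx0. Qed.

Lemma adj_row_mx m n p (A : 'M[C]_(m, n)) (B : 'M[C]_(m, p)) :
  adj (row_mx A B) = col_mx (adj A) (adj B).
Proof. by rewrite /adj map_row_mx tr_row_mx. Qed.

Lemma adj_col_mx m n p (A : 'M[C]_(m, n)) (B : 'M[C]_(p, n)) :
  adj (col_mx A B) = row_mx (adj A) (adj B).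
Proof. by rewrite /adj map_col_mx tr_col_mx. Qed.

Lemma mxtrace_adj n (A : 'M[C]_n) : \tr (adj A) = Num.conj (\tr A).
Proof. by rewrite /mxtrace rmorph_sum; apply: eq_bigr => i _; rewrite adjE. Qed.

Lemma mxtrace_mul_adj m n (A : 'M[C]_(m, n)) :
  \tr (adj A *m A) = \sum_j \sum_i `|A i j| ^+ 2.
Proof.
apply: eq_bigr => j _; rewrite mxE; apply: eq_bigr => i _.
by rewrite adjE normCK mulrC.
Qed.

Lemma frobenius_ge0 m n (A : 'M[C]_(m, n)) : 0 <= \tr (adj A *m A).
Proof.
rewrite mxtrace_mul_adj; apply: sumr_ge0 => j _; apply: sumr_ge0 => i _.
by rewrite exprn_ge0.
Qed.

(** A sum of squared moduli vanishes only termwise. Several matrix equalities below are proved by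
    applying this to a difference. *)
Lemma frobenius_eq0 m n (A : 'M[C]_(m, n)) : \tr (adj A *m A) = 0 -> A = 0.
Proof.
rewrite mxtrace_mul_adj => /eqP; rewrite psumr_eq0; last first.
  by move=> j _; apply: sumr_ge0 => i _; rewrite exprn_ge0.
move=> /allP A0; apply/matrixP => i j; have := A0 j (mem_index_enum j).
rewrite psumr_eq0 /=; last by move=> k _; rewrite exprn_ge0.
move=> /allP /(_ i (mem_index_enum i)); rewrite /= expf_eq0 /= normr_eq0.
by move=> /eqP ->; rewrite mxE.
Qed.

Lemma psd_gram m n (B : 'M[C]_(m, n)) : psd (B *m adj B).
Proof.
split=> [|v]; first by rewrite adjM adjK.
rewrite !mulmxA -mulmxA -[adj v *m B]adjK adjM adjK -[X in 0 <= X]trace_mx11.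
exact: frobenius_ge0.
Qed.

Lemma psdD n (A B : 'M[C]_n) : psd A -> psd B -> psd (A + B).
Proof.
move=> [Ah Ap] [Bh Bp]; split=> [|v]; first by rewrite adjD -Ah -Bh.
by rewrite mulmxDr mulmxDl mxE addr_ge0.
Qed.

Lemma hermitian_spectral n (A : 'M[C]_n) : A = adj A ->
  exists (P : 'M[C]_n) (d : 'rV[C]_n),
    adj P *m P = 1%:M /\ A = P *m diag_mx d *m adj P.
Proof.
move=> Ah.
have adjt (B : 'M[C]_n) : map_mx Num.conj (B^T) = adj B by rewrite /adj map_trmx.
have /spectral.orthomx_spectralP eA : A \is spectral.normalmx.
  by apply/spectral.normalmxP; rewrite adjt -Ah.
have /spectral.unitarymxP := spectral.spectral_unitarymx A.
rewrite adjt => PP.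
exists (adj (spectral.spectralmx A)), (spectral.spectral_diag A); rewrite adjK.
by split=> //; rewrite {1}eA spectral.invmx_unitary ?spectral.spectral_unitarymx ?adjt.
Qed.

Lemma psd_spectral n (A : 'M[C]_n) : psd A ->
  exists (P : 'M[C]_n) (d : 'rV[C]_n),
    [/\ adj P *m P = 1%:M, A = P *m diag_mx d *m adj P & forall i, 0 <= d 0 i].
Proof.
move=> [/hermitian_spectral [P [d [PP eA]]] Ap]; exists P, d; split=> // i.
(* The test vector is the i-th eigenvector, where the quadratic form equals [d 0 i]. *)
have := Ap (P *m delta_mx i 0).
rewrite eA adjM !mulmxA -[_ *m adj P *m P]mulmxA PP mulmx1.
rewrite -[_ *m adj P *m P]mulmxA PP mulmx1.
suff -> : (adj (delta_mx i 0) *m diag_mx d *m delta_mx i 0 : 'M_1) 0 0 = d 0 i by [].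
rewrite -colE mxE mul_mx_diag !mxE eqxx /= ?conjC1 ?rmorph1 ?mulr1 ?mul1r //.
Qed.

(** Take [P] times the square root of the spectrum; a Gram factorisation is enough, so [B] is not
    made Hermitian. *)
Lemma psd_sqrt n (A : 'M[C]_n) : psd A -> exists B : 'M[C]_n, A = B *m adj B.
Proof.
move=> /psd_spectral [P [d [PP -> dp]]].
exists (P *m diag_mx (map_mx sqrtC d)); rewrite adjM mulmxA; congr (_ *m _).
rewrite -[RHS]mulmxA; congr (_ *m _).
have -> : adj (diag_mx (map_mx sqrtC d)) = diag_mx (map_mx sqrtC d).
  apply/matrixP=> i j; rewrite adjE !mxE eq_sym; case: eqP => [->|] /=.
    by rewrite !mulr1n geC0_conj // sqrtC_ge0.
  by rewrite !mulr0n conjC0.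
rewrite mulmx_diag; congr diag_mx; apply/rowP=> i.
by rewrite !mxE -expr2 sqrtCK.
Qed.

(* The eigenvalues d of A satisfy d <= 1 and sum d = sum d^2 = 1. *)
Lemma pure_density n (A : 'M[C]_n) : density A -> \tr (A *m A) = 1 ->
  exists psi : 'cV[C]_n, adj psi *m psi = 1%:M /\ A = psi *m adj psi.
Proof.
move=> [/psd_spectral [P [d [PP eA dp]]] trA] trA2.
have sum_d : \sum_i d 0 i = 1.
  by rewrite -trA eA mxtrace_mulC mulmxA PP mul1mx mxtrace_diag.
have sum_d2 : \sum_i d 0 i * d 0 i = 1.
  rewrite -trA2 eA mulmxA mxtrace_mulC !mulmxA PP mul1mx -!mulmxA.
  rewrite (isoK _ PP) mulmx_diag mxtrace_diag.
  by apply: eq_bigr => i _; rewrite !mxE.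
have le1 i : d 0 i <= 1.
  by rewrite -sum_d (bigD1 i) //= lerDl sumr_ge0.
(* These terms are nonnegative and sum to 1 - 1, so every eigenvalue is 0 or 1. *)
have d01 i : d 0 i * (1 - d 0 i) = 0.
  have /eqP : \sum_i d 0 i * (1 - d 0 i) = 0.
    under eq_bigr => j _ do rewrite mulrBr mulr1.
    by rewrite sumrB sum_d sum_d2 subrr.
  rewrite psumr_eq0 => [/allP /(_ i (mem_index_enum i)) /eqP //|j _].
  by rewrite mulr_ge0 ?subr_ge0.
have [i di] : exists i, d 0 i != 0.
  apply/existsP; apply: contra_eqT sum_d => /existsPn d0.
  rewrite big1 => [|i _]; last by apply/eqP; rewrite -[_ == _]negbK d0.
  by rewrite eq_sym oner_eq0.
have di1 : d 0 i = 1.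
  have /eqP := d01 i; rewrite mulf_eq0 (negbTE di) /= subr_eq0.
  by move=> /eqP <-.
(* The eigenvalue at [i] already exhausts the trace, which forces rank one. *)
have dj0 j : j != i -> d 0 j = 0.
  move=> ji; have /eqP : \sum_(j | j != i) d 0 j = 0.
    by move: sum_d; rewrite (bigD1 i) //= di1 => /(canRL (addKr _)) ->; rewrite addNr.
  rewrite psumr_eq0 => [/allP /(_ j (mem_index_enum j)) /implyP /(_ ji) /eqP //|k _].
  exact: dp.
have d_delta : diag_mx d = delta_mx i (0 : 'I_1) *m adj (delta_mx i (0 : 'I_1)).
  apply/matrixP=> j k; rewrite !mxE big_ord1 adjE !mxE !andbT conjC_nat.
  have [->|ji] := eqVneq j i; last by rewrite dj0 // mul0rn mul0r.
  by rewrite eq_sym di1 mul1r.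
exists (P *m delta_mx i 0); split.
  rewrite adjM -mulmxA (isoK _ PP).
  apply/matrixP=> a b; rewrite !ord1 -colE !mxE eqxx.
  by rewrite eqxx /= conjC1.
by rewrite eA d_delta adjM !mulmxA.
Qed.

(** * Tensor products and the partial trace *)

Lemma sum_mxtens m n (F : 'I_(m * n) -> C) :
  \sum_p F p = \sum_i \sum_j F (mxtens_index (i, j)).
Proof.
rewrite pair_bigA; apply: (reindex (fun p => mxtens_index (p.1, p.2))).
by exists (@mxtens_unindex m n) => [[i j] _|p _]; rewrite ?mxtens_indexK // -[RHS]mxtens_unindexK.
Qed.

Lemma sum_delta (T : finType) (j : T) (F : T -> C) :
  \sum_i (i == j)%:R * F i = F j.
Proof.
rewrite (bigD1 j) //= eqxx mul1r big1 ?addr0 // => i /negbTE ->.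
by rewrite mul0r.
Qed.

Definition ptr {a b} (Y : 'M[C]_(a * b)) : 'M[C]_a :=
  \matrix_(i, j) \sum_k Y (mxtens_index (i, k)) (mxtens_index (j, k)).

(* [embl u] is u (x) id and [embr w] is id (x) w; as [u *t 1%:M] they would have [1 * b] or
   [a * 1] columns, which is not convertible to [b] or [a]. *)
Definition embl {a b} (u : 'cV[C]_a) : 'M[C]_(a * b, b) :=
  \matrix_(p, k) (((mxtens_unindex p).2 == k)%:R * u (mxtens_unindex p).1 0).

Definition embr {a b} (w : 'cV[C]_b) : 'M[C]_(a * b, a) :=
  \matrix_(p, i) (((mxtens_unindex p).1 == i)%:R * w (mxtens_unindex p).2 0).

Lemma mxtens_matrixP m n p q (A B : 'M[C]_(m * n, p * q)) :
  (forall i j k l, A (mxtens_index (i, j)) (mxtens_index (k, l)) =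
                   B (mxtens_index (i, j)) (mxtens_index (k, l))) -> A = B.
Proof.
move=> AB; apply/matrixP => x y.
by case: (mxtens_indexP x) => i j; case: (mxtens_indexP y) => k l.
Qed.

Lemma mul_emblE a b r (u : 'cV[C]_a) (Y : 'M[C]_(b, r)) i k s :
  (embl u *m Y) (mxtens_index (i, k)) s = u i 0 * Y k s.
Proof.
rewrite mxE -(sum_delta k (fun k' => u i 0 * Y k' s)).
by apply: eq_bigr => k' _; rewrite !mxE !mxtens_indexK /= eq_sym mulrA.
Qed.

Lemma mul_embrE a b r (w : 'cV[C]_b) (Y : 'M[C]_(a, r)) i k s :
  (embr w *m Y) (mxtens_index (i, k)) s = w k 0 * Y i s.
Proof.
rewrite mxE -(sum_delta i (fun i' => w k 0 * Y i' s)).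
by apply: eq_bigr => k' _; rewrite !mxE !mxtens_indexK /= eq_sym mulrA.
Qed.

(** Moves a right factor [adj B] to the left, where the entry formulas for [embl] and [embr]
    apply. *)
Lemma mul_adjE m n p q (A : 'M[C]_(m, n)) (B : 'M[C]_(p, q)) (X : 'M[C]_(n, q)) i j :
  (A *m X *m adj B) i j = Num.conj ((B *m adj (A *m X)) j i).
Proof. by rewrite -adjE adjM adjK. Qed.

Lemma embl_conj a b (u v : 'cV[C]_a) (Y : 'M[C]_b) :
  embl u *m Y *m adj (embl v) = (u *m adj v) *t Y.
Proof.
apply: mxtens_matrixP => i k j l.
rewrite mul_adjE mul_emblE adjE mul_emblE tensmxE rmorphM /= conjCK.
by rewrite mxE big_ord1 adjE mulrA [Num.conj _ * _]mulrC.
Qed.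

Lemma embr_conj a b (w x : 'cV[C]_b) (X : 'M[C]_a) :
  embr w *m X *m adj (embr x) = X *t (w *m adj x).
Proof.
apply: mxtens_matrixP => i k j l.
rewrite mul_adjE mul_embrE adjE mul_embrE tensmxE rmorphM /= conjCK.
by rewrite mxE big_ord1 adjE mulrA mulrC [Num.conj _ * _]mulrC.
Qed.

Lemma embl_dot a b (u v : 'cV[C]_a) :
  adj (embl u) *m embl v = ((adj u *m v) 0 0)%:M :> 'M[C]_b.
Proof.
apply/matrixP=> k l; rewrite mxE sum_mxtens.
under eq_bigr => i _.
  rewrite (eq_bigr (fun j => (j == k)%:R * ((k == l)%:R * (Num.conj (u i 0) * v i 0)))).
    rewrite sum_delta; over.
  move=> j _; rewrite adjE !mxE !mxtens_indexK /= rmorphM /= conjC_nat.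
  case: eqP => [->|]; last by rewrite !mul0r.
  by rewrite !mul1r mulrCA.
rewrite -mulr_sumr !mxE mulr_natl; congr (_ *+ _).
by apply: eq_bigr => i _; rewrite adjE.
Qed.

Lemma embr_dot a b (w x : 'cV[C]_b) :
  adj (embr w) *m embr x = ((adj w *m x) 0 0)%:M :> 'M[C]_a.
Proof.
apply/matrixP=> k l; rewrite mxE sum_mxtens exchange_big /=.
under eq_bigr => i _.
  rewrite (eq_bigr (fun j => (j == k)%:R * ((k == l)%:R * (Num.conj (w i 0) * x i 0)))).
    rewrite sum_delta; over.
  move=> j _; rewrite adjE !mxE !mxtens_indexK /= rmorphM /= conjC_nat.
  case: eqP => [->|]; last by rewrite !mul0r.
  by rewrite !mul1r mulrCA.
rewrite -mulr_sumr !mxE mulr_natl; congr (_ *+ _).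
by apply: eq_bigr => i _; rewrite adjE.
Qed.

Lemma adj_embr_mulE a b r (w : 'cV[C]_b) (Y : 'M[C]_(a * b, r)) i s :
  (adj (embr w) *m Y) i s = \sum_k Num.conj (w k 0) * Y (mxtens_index (i, k)) s.
Proof.
rewrite mxE sum_mxtens exchange_big; apply: eq_bigr => k _ /=.
rewrite -(sum_delta i (fun i' => Num.conj (w k 0) * Y (mxtens_index (i', k)) s)).
apply: eq_bigr => j _; rewrite adjE !mxE !mxtens_indexK /= rmorphM /= conjC_nat.
by rewrite mulrA.
Qed.

Lemma adj_embl_mulE a b r (u : 'cV[C]_a) (Y : 'M[C]_(a * b, r)) k s :
  (adj (embl u) *m Y) k s = \sum_i Num.conj (u i 0) * Y (mxtens_index (i, k)) s.
Proof.
rewrite mxE sum_mxtens; apply: eq_bigr => i _ /=.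
rewrite -(sum_delta k (fun k' => Num.conj (u i 0) * Y (mxtens_index (i, k')) s)).
apply: eq_bigr => j _; rewrite adjE !mxE !mxtens_indexK /= rmorphM /= conjC_nat.
by rewrite mulrA.
Qed.

Lemma mul_adj2E m n q (A : 'M[C]_(m, n)) (B : 'M[C]_(m, q)) (Y : 'M[C]_(m, m)) i j :
  (adj A *m Y *m B) i j = Num.conj ((adj B *m adj (adj A *m Y)) j i).
Proof. by rewrite -adjE !adjM !adjK. Qed.

(** The Kraus form of the partial trace, from which its complete positivity follows. *)
Lemma ptr_kraus a b (Y : 'M[C]_(a * b)) :
  ptr Y = \sum_k adj (embr (delta_mx k 0)) *m Y *m embr (delta_mx k 0).
Proof.
apply/matrixP => i j; rewrite mxE summxE; apply: eq_bigr => k _.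
have conj_delta k' : Num.conj ((delta_mx k 0 : 'cV[C]_b) k' 0) = (k' == k)%:R.
  by rewrite !mxE andbT conjC_nat.
rewrite mul_adj2E adj_embr_mulE; under eq_bigr => k' _ do rewrite conj_delta.
rewrite sum_delta adjE conjCK adj_embr_mulE.
by under eq_bigr => k' _ do rewrite conj_delta; rewrite sum_delta.
Qed.

Lemma ptr_tens a b (X : 'M[C]_a) (Y : 'M[C]_b) : ptr (X *t Y) = \tr Y *: X.
Proof.
apply/matrixP => i j; rewrite !mxE mulr_suml; apply: eq_bigr => k _.
by rewrite tensmxE mulrC.
Qed.

Lemma mxtrace_ptr a b (Y : 'M[C]_(a * b)) : \tr (ptr Y) = \tr Y.
Proof. by rewrite [RHS]sum_mxtens; apply: eq_bigr => i _; rewrite mxE. Qed.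

Lemma mxtrace_tens a b (X : 'M[C]_a) (Y : 'M[C]_b) : \tr (X *t Y) = \tr X * \tr Y.
Proof. by rewrite -mxtrace_ptr ptr_tens mxtraceZ mulrC. Qed.

(** Duality between embedding and partial trace: the weight of [Y] on a vector of the left factor is
    read off its marginal. *)
Lemma mxtrace_embl a b (u v : 'cV[C]_a) (Y : 'M[C]_(a * b)) :
  \tr (adj (embl u) *m Y *m embl v) = (adj u *m ptr Y *m v) 0 0.
Proof.
rewrite mxE; transitivity (\sum_k \sum_j \sum_i
  Num.conj (u i 0) * Y (mxtens_index (i, k)) (mxtens_index (j, k)) * v j 0).
  apply: eq_bigr => k _; rewrite mul_adj2E adj_embl_mulE rmorph_sum /=.
  apply: eq_bigr => j _; rewrite rmorphM /= conjCK adjE conjCK.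
  by rewrite adj_embl_mulE mulr_sumr; apply: eq_bigr => i _; rewrite mulrC.
rewrite exchange_big; apply: eq_bigr => j _; rewrite exchange_big mxE mulr_suml.
apply: eq_bigr => i _; rewrite adjE mxE mulr_sumr mulr_suml.
exact: eq_bigr.
Qed.

(* G is the matrix of a purification of the bipartite state G G^*. The Frobenius norm of
   G - E E^* G is 1 minus the weight of the marginal on psi, hence 0. *)
Lemma pure_marginal a b r (G : 'M[C]_(a * b, r)) (psi : 'cV[C]_a) :
  adj psi *m psi = 1%:M -> ptr (G *m adj G) = psi *m adj psi ->
  G = embl psi *m (adj (embl psi) *m G).
Proof.
move=> psi1 ptrG; set E : 'M[C]_(a * b, b) := embl psi.
have EE : adj E *m E = 1%:M by rewrite embl_dot psi1 mxE eqxx.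
apply/eqP; rewrite -subr_eq0; apply/eqP/frobenius_eq0.
(* Pythagoras for the projector [E *m adj E]. *)
have -> : adj (G - E *m (adj E *m G)) *m (G - E *m (adj E *m G)) =
    adj G *m G - adj G *m E *m adj E *m G.
  rewrite adjB !adjM adjK mulmxBr !mulmxBl -!mulmxA (isoK _ EE).
  by rewrite subrr subr0.
rewrite linearB /= mxtrace_mulC -mxtrace_ptr ptrG -!mulmxA (mxtrace_mulC (adj G)).
have -> : E *m (adj E *m G) *m adj G = E *m (adj E *m (G *m adj G)) by rewrite !mulmxA.
rewrite [X in _ - X]mxtrace_mulC /E mxtrace_embl ptrG (isoK _ psi1) psi1 mxtrace_mulC psi1.
by rewrite mxtrace1 mxE subrr.
Qed.

(** * Completely positive maps and Stinespring dilations *)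

Lemma linear_map0 n m (f : 'M[C]_n -> 'M[C]_m) : linear_map f -> f 0 = 0.
Proof.
move=> fL; have := fL 1 0 0; rewrite !scale1r addr0 => /eqP.
by rewrite -subr_eq0 opprD addrA subrr sub0r oppr_eq0 => /eqP.
Qed.

Lemma linear_map_sum n m (f : 'M[C]_n -> 'M[C]_m) (T : finType)
    (c : T -> C) (A : T -> 'M[C]_n) : linear_map f ->
  f (\sum_t c t *: A t) = \sum_t c t *: f (A t).
Proof.
move=> fL; elim/big_rec2: _ => [|t _ Y _ <-]; first exact: linear_map0.
by rewrite fL.
Qed.

(** [ampl] sees only the values of the map, so a map may be replaced by its Kraus form. *)
Lemma cp_ext n m (f g : 'M[C]_n -> 'M[C]_m) :
  f =1 g -> completely_positive f -> completely_positive g.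
Proof.
move=> fg fP k X /fP; suff -> : ampl f X = ampl g X by [].
by apply/matrixP=> i j; rewrite !mxE fg.
Qed.

Lemma cp_comp n m p (f : 'M[C]_n -> 'M[C]_m) (g : 'M[C]_m -> 'M[C]_p) :
  completely_positive f -> completely_positive g ->
  completely_positive (fun X => g (f X)).
Proof.
move=> fP gP k X /fP /gP.
suff -> : ampl g (ampl f X) = ampl (fun X => g (f X)) X by [].
apply/matrixP=> i j; rewrite !mxE; congr (g _ _ _).
by apply/matrixP=> a b; rewrite !mxE !mxtens_indexK.
Qed.

Lemma psd0 n : psd (0 : 'M[C]_n).
Proof. by split=> [|v]; rewrite ?adj0 // mulmx0 mul0mx mxE. Qed.

Lemma cp0 n m : completely_positive (fun _ : 'M[C]_n => 0 : 'M[C]_m).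
Proof.
move=> k X _; suff -> : ampl (fun _ : 'M[C]_n => 0 : 'M[C]_m) X = 0 by exact: psd0.
by apply/matrixP=> i j; rewrite !mxE.
Qed.

Lemma cpD n m (f g : 'M[C]_n -> 'M[C]_m) :
  completely_positive f -> completely_positive g ->
  completely_positive (fun X => f X + g X).
Proof.
move=> fP gP k X Xp; have := psdD (fP k X Xp) (gP k X Xp).
suff -> : ampl f X + ampl g X = ampl (fun X => f X + g X) X by [].
by apply/matrixP=> i j; rewrite !mxE.
Qed.

Lemma cp_sum n m (T : finType) (f : T -> 'M[C]_n -> 'M[C]_m) :
  (forall t, completely_positive (f t)) ->
  completely_positive (fun X => \sum_t f t X).
Proof.
move=> fP; suff cp_seq (s : seq T) : completely_positive (fun X => \sum_(t <- s) f t X).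
  exact: cp_seq.
elim: s => [|t s IHs].
  by apply: cp_ext (@cp0 n m) => X; rewrite big_nil.
by apply: cp_ext (cpD (fP t) IHs) => X; rewrite big_cons.
Qed.

Lemma tens1_mulE k m n r (K : 'M[C]_(m, n)) (G : 'M[C]_(k * n, r)) i a s :
  ((1%:M *t K) *m G) (mxtens_index (i, a)) s =
  \sum_c K a c * G (mxtens_index (i, c)) s.
Proof.
rewrite mxE sum_mxtens exchange_big; apply: eq_bigr => c _ /=.
rewrite -(sum_delta i (fun i' => K a c * G (mxtens_index (i', c)) s)).
by apply: eq_bigr => i' _; rewrite tensmxE mxE mulrA eq_sym.
Qed.

(** The amplification is conjugation by the identity tensor [K], which sends a Gram matrix to a Gram
    matrix. *)
Lemma cp_conj n m (K : 'M[C]_(m, n)) :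
  completely_positive (fun X => K *m X *m adj K).
Proof.
move=> k X /psd_sqrt [B ->].
suff -> : ampl (fun X => K *m X *m adj K) (B *m adj B) =
    ((1%:M : 'M_k) *t K *m B) *m adj ((1%:M : 'M_k) *t K *m B) by exact: psd_gram.
rewrite adjM !mulmxA -(mulmxA (1%:M *t K)).
apply: mxtens_matrixP => i a j b.
rewrite mul_adjE tens1_mulE mxE !mxtens_indexK /= mul_adjE.
congr (Num.conj _); rewrite mxE; apply: eq_bigr => c _; congr (_ * _).
rewrite !adjE tens1_mulE mxE; congr (Num.conj _).
by apply: eq_bigr => d _; rewrite [in LHS]mxE.
Qed.

Lemma mulmx_sum_col m n (B : 'M[C]_(m, n)) :
  B *m adj B = \sum_k col k B *m adj (col k B).
Proof.
apply/matrixP=> i j; rewrite mxE summxE; apply: eq_bigr => k _.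
by rewrite [RHS]mxE big_ord1 !adjE !mxE.
Qed.

Lemma tens_sumr a b (T : finType) (X : 'M[C]_a) (Y : T -> 'M[C]_b) :
  X *t (\sum_t Y t) = \sum_t X *t Y t.
Proof.
apply/matrixP=> i j; rewrite mxE !summxE mulr_sumr.
by apply: eq_bigr => t _; rewrite mxE.
Qed.

(** Factoring [om] as S S^*, each column of S gives one Kraus operator. *)
Lemma cp_tens n c (om : 'M[C]_c) : psd om ->
  completely_positive (fun X : 'M[C]_n => X *t om).
Proof.
move=> /psd_sqrt [S ->].
apply: cp_ext (cp_sum (fun k => cp_conj (embr (col k S)))) => X /=.
by under eq_bigr => k _ do rewrite embr_conj; rewrite mulmx_sum_col tens_sumr.
Qed.

Lemma cp_ptr a b : completely_positive (@ptr a b).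
Proof.
apply: cp_ext (cp_sum (fun k => cp_conj (adj (embr (delta_mx k 0))))) => X /=.
by under eq_bigr => k _ do rewrite adjK; rewrite ptr_kraus.
Qed.

Lemma ptrD a b (c : C) (X Y : 'M[C]_(a * b)) : ptr (c *: X + Y) = c *: ptr X + ptr Y.
Proof.
apply/matrixP=> i j; rewrite !mxE mulr_sumr -big_split.
by apply: eq_bigr => k _; rewrite !mxE.
Qed.

(** Adjoin an ancilla in state [om], apply an isometry, discard the right factor: each stage is
    completely positive and keeps the trace. *)
Lemma cptp_dilation n a b c (W : 'M[C]_(a * b, n * c)) (om : 'M[C]_c) :
  adj W *m W = 1%:M -> density om ->
  CPTP (fun X : 'M[C]_n => ptr (W *m (X *t om) *m adj W)).
Proof.
move=> WW [omp om1]; split.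
- move=> x A B; rewrite -ptrD; congr ptr.
  have -> : (x *: A + B) *t om = x *: (A *t om) + B *t om.
    by apply/matrixP=> i j; rewrite !mxE mulrDl mulrA.
  by rewrite mulmxDr mulmxDl -scalemxAr -scalemxAl.
- exact: cp_comp (cp_comp (@cp_tens n c om omp) (@cp_conj _ _ W)) (@cp_ptr a b).
- by move=> X; rewrite mxtrace_ptr mxtrace_mulC mulmxA WW mul1mx mxtrace_tens om1 mulr1.
Qed.

Lemma mul_delta_trace n (A : 'M[C]_n) i j : \tr (A *m delta_mx j i) = A i j.
Proof.
rewrite /mxtrace (bigD1 i) //= big1 ?addr0 => [|k ki].
  rewrite mxE (bigD1 j) //= big1 ?addr0 => [|l lj]; first by rewrite mxE !eqxx mulr1.
  by rewrite mxE (negbTE lj) mulr0.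
by rewrite mxE big1 // => l _; rewrite mxE (negbTE ki) andbF mulr0.
Qed.

(* The Choi matrix of f, factored as B B^*, is V after reshuffling indices. *)
Lemma stinespring n m (f : 'M[C]_n -> 'M[C]_m) : CPTP f ->
  exists V : 'M[C]_(m * (n * m), n),
    adj V *m V = 1%:M /\ forall X, f X = ptr (V *m X *m adj V).
Proof.
move=> [fL fP fT].
(* The unnormalised maximally entangled vector; amplifying [f] on its projector gives the Choi
   matrix, with blocks [f (delta_mx i j)]. *)
pose v : 'cV[C]_(n * n) := \col_p ((mxtens_unindex p).1 == (mxtens_unindex p).2)%:R.
have [B choiE] := psd_sqrt (fP n _ (psd_gram v)).
pose V : 'M[C]_(m * (n * m), n) :=
  \matrix_(p, i) B (mxtens_index (i, (mxtens_unindex p).1)) (mxtens_unindex p).2.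
have fV X : f X = ptr (V *m X *m adj V).
  have f_delta i j a b : f (delta_mx i j) a b =
      \sum_k B (mxtens_index (i, a)) k * Num.conj (B (mxtens_index (j, b)) k).
    have := congr1 (fun Y : 'M[C]_(n * m) => Y (mxtens_index (i, a)) (mxtens_index (j, b))) choiE.
    rewrite /= [in LHS]mxE !mxtens_indexK /=.
    rewrite (_ : (\matrix_(_, _) _) = delta_mx i j); last first.
      apply/matrixP=> c d; rewrite !mxE big_ord1 adjE !mxE !mxtens_indexK /= conjC_nat.
      by rewrite -natrM mulnb eq_sym [d == _]eq_sym.
    by move=> ->; rewrite mxE; apply: eq_bigr => k _; rewrite adjE.
  rewrite {1}[X]matrix_sum_delta pair_bigA /= linear_map_sum //.
  apply/matrixP=> a b; rewrite summxE mxE.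
  under eq_bigr => p _ do rewrite mxE f_delta mulr_sumr.
  rewrite exchange_big; apply: eq_bigr => k _ /=.
  rewrite mxE -(pair_bigA _ (fun i j => X i j * (B (mxtens_index (i, a)) k *
    Num.conj (B (mxtens_index (j, b)) k)))) /= exchange_big; apply: eq_bigr => j _ /=.
  rewrite adjE !mxE !mxtens_indexK /= mulr_suml; apply: eq_bigr => i _.
  by rewrite !mxE !mxtens_indexK /= mulrA; congr (_ * _); rewrite mulrC.
exists V; split=> //; apply/matrixP=> i j.
(* Trace preservation on matrix units gives the entries of [adj V *m V]. *)
rewrite -mul_delta_trace -mulmxA mxtrace_mulC -mxtrace_ptr -fV fT.
by rewrite -[delta_mx j i]mul1mx mul_delta_trace.
Qed.

(** * From a purifying channel to the decomposition *)

Lemma iso_dot m n p q (V : 'M[C]_(m, n)) (X : 'M[C]_(n, p)) (Y : 'M[C]_(n, q)) :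
  adj V *m V = 1%:M -> adj (V *m X) *m (V *m Y) = adj X *m Y.
Proof. by move=> VV; rewrite adjM -mulmxA (isoK _ VV). Qed.

Lemma isometry_row_mx m n p (A : 'M[C]_(m, n)) (B : 'M[C]_(m, p)) :
  adj A *m A = 1%:M -> adj B *m B = 1%:M -> adj A *m B = 0 ->
  adj (row_mx A B) *m row_mx A B = 1%:M.
Proof.
move=> AA BB AB; have BA : adj B *m A = 0 by rewrite -[LHS]adjK adjM adjK AB adj0.
by rewrite adj_row_mx mul_col_row AA BB AB BA -scalar_mx_block.
Qed.

(** The equality [m = n] is propositional so as to cover shapes such as [p] against
    [r + (p - r)]. *)
Lemma square_isometry m n (A : 'M[C]_(m, n)) :
  m = n -> adj A *m A = 1%:M -> A *m adj A = 1%:M.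
Proof. by move=> mn; move: A; rewrite mn => A /mulmx1C. Qed.

(** Gram-Schmidt on the left kernel of [B], of dimension [N - r] since [B] has full column rank; the
    adjoint of the result is [Bc]. *)
Lemma isometry_complement N r (B : 'M[C]_(N, r)) : adj B *m B = 1%:M ->
  exists Bc : 'M[C]_(N, N - r), adj Bc *m Bc = 1%:M /\ adj B *m Bc = 0.
Proof.
move=> BB.
have adjt m n (A : 'M[C]_(m, n)) : map_mx Num.conj (A^T) = adj A by rewrite /adj map_trmx.
have rankB : \rank (kermx B) = (N - r)%N.
  rewrite mxrank_ker; congr (_ - _)%N; apply/eqP; rewrite eqn_leq rank_leq_col /=.
  by apply: (@mulmx1_min_rank _ _ _ _ _ (adj B) 1%:M); rewrite mulmx1.
have /spectral.unitarymxP :=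
  spectral.schmidt_unitarymx (row_base (kermx B)) (rank_leq_col _).
have : (spectral.schmidt (row_base (kermx B)) <= kermx B)%MS.
  by rewrite spectral.eqmx_schmidt_free ?row_base_free // eq_row_base.
move: (spectral.schmidt _); rewrite rankB => S /sub_kermxP SB; rewrite adjt => SS.
by exists (adj S); rewrite adjK -adjM SB adj0.
Qed.

(** Complete both frames to orthonormal bases and map one basis to the other. *)
Lemma unitary_extension p q r (A : 'M[C]_(q, r)) (B : 'M[C]_(p, r)) :
  q = p -> adj A *m A = 1%:M -> adj B *m B = 1%:M ->
  exists U : 'M[C]_(q, p), unitary U /\ U *m B = A.
Proof.
move=> qp AA BB; have rp : (r <= p)%N by apply: mulmx1_min BB.
subst q.
have [Ac [AcAc AAc]] := isometry_complement AA.
have [Bc [BcBc BBc]] := isometry_complement BB.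
have psum : p = (r + (p - r))%N by rewrite subnKC.
have Aiso := isometry_row_mx AA AcAc AAc; have Aco := square_isometry psum Aiso.
have Biso := isometry_row_mx BB BcBc BBc; have Bco := square_isometry psum Biso.
exists (row_mx A Ac *m adj (row_mx B Bc)); split; first split.
- by rewrite adjM adjK mulmxA (isoKr _ Biso).
- by rewrite adjM adjK mulmxA (isoKr _ Aiso).
- rewrite -mulmxA adj_row_mx mul_col_mx BB.
  by rewrite -[adj Bc *m B]adjK adjM adjK BBc adj0 mul_row_col mulmx1 mulmx0 addr0.
Qed.

Definition coef_mx a b (u : 'cV[C]_(a * b)) : 'M[C]_(a, b) :=
  \matrix_(i, k) u (mxtens_index (i, k)) 0.

Lemma coef_mx_gram a b (u : 'cV[C]_(a * b)) :
  coef_mx u *m adj (coef_mx u) = ptr (u *m adj u).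
Proof.
apply/matrixP=> i j; rewrite [LHS]mxE [RHS]mxE; apply: eq_bigr => k _.
by rewrite [RHS]mxE big_ord1 !adjE !mxE.
Qed.

Lemma coef_mx_dot a b (u v : 'cV[C]_(a * b)) :
  \tr (adj (coef_mx u) *m coef_mx v) = (adj u *m v) 0 0.
Proof.
rewrite [RHS]mxE sum_mxtens exchange_big; apply: eq_bigr => k _ /=.
by rewrite [LHS]mxE; apply: eq_bigr => i _; rewrite !adjE !mxE.
Qed.

Lemma density_dim n (A : 'M[C]_n) : density A -> (0 < n)%N.
Proof.
case: n A => // A [_]; rewrite /mxtrace big_ord0 => /esym/eqP.
by rewrite oner_eq0.
Qed.

Lemma mx11_1 (A : 'M[C]_1) : A 0 0 = 1 -> A = 1%:M.
Proof. by move=> A1; rewrite [A]mx11_scalar A1. Qed.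

(** Positivity is read off the dilation: complete positivity at [k = 1] concerns [1 * n], which is
    not convertible to [n]. *)
Lemma cptp_density n m (f : 'M[C]_n -> 'M[C]_m) A : CPTP f -> density A -> density (f A).
Proof.
move=> fP; have [_ _ fT] := fP; have [V [_ fV]] := stinespring fP.
case=> /psd_sqrt [B ->] trB; split; last by rewrite fT.
rewrite fV ptr_kraus.
elim/big_ind: _ => [|X Y|k _]; [exact: psd0 | exact: psdD |].
set L := embr _; have := psd_gram (adj L *m (V *m B)).
by rewrite !adjM adjK !mulmxA.
Qed.

(* V and W dilate the purifying and the reversing channel. The state rho belongs to the class
   sigma when V rho V^* = psi psi^* (x) sigma; W psi is then a purification of rho. *)
Definition env_class n m e d (V : 'M[C]_(m * e, n)) (W : 'M[C]_(n * d, m))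
    (M : 'M[C]_n -> Prop) (sigma : 'M[C]_e) (rho : 'M[C]_n) : Prop :=
  M rho /\ exists (psi : 'cV[C]_m) (S : 'M[C]_(e, d)),
    [/\ adj psi *m psi = 1%:M, V *m coef_mx (W *m psi) = embl psi *m S,
        rho = coef_mx (W *m psi) *m adj (coef_mx (W *m psi)) & sigma = S *m adj S].

Section EnvClass.
Variables (n m e d : nat) (V : 'M[C]_(m * e, n)) (W : 'M[C]_(n * d, m)).
Variable M : 'M[C]_n -> Prop.
Hypotheses (VV : adj V *m V = 1%:M) (WW : adj W *m W = 1%:M).
Hypothesis MD : forall rho, M rho -> density rho.

(* With z = <psi, psi'>, comparing the overlap of the two purifications before and
   after V gives z = z tr(S^* S'); so z = 0, or S = S' as both have Frobenius norm 1. *)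
Lemma env_class_orth sigma sigma' : sigma <> sigma' ->
  orth_sets (env_class V W M sigma) (env_class V W M sigma').
Proof.
move=> neq rho rho' [Mr [psi [S [psi1 VA er es]]]] [Mr' [psi' [S' [psi1' VA' er' es']]]].
move: VA VA' er er'; set A := coef_mx _; set A' := coef_mx _ => VA VA' er er'.
pose z := (adj psi *m psi') 0 0.
have trAA' : \tr (adj A *m A') = z.
  by rewrite coef_mx_dot (iso_dot _ _ WW).
have AA' : adj A *m A' = z *: (adj S *m S').
  rewrite -(iso_dot _ _ VV) VA VA' adjM -mulmxA.
  by rewrite (mulmxA (adj (embl psi))) embl_dot mul_scalar_mx -scalemxAr.
have [z0|z0] := eqVneq z 0.
  rewrite er er' -mulmxA (mulmxA (adj A)) AA' z0 scale0r mul0mx mulmx0.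
  by rewrite linear0.
have trSS' : \tr (adj S *m S') = 1.
  move: trAA'; rewrite AA' mxtraceZ -{2}[z]mulr1 => /mulfI; exact.
(* [V] and [embl psi0] are isometries, so the squared norm of [S0] is the trace of [rho0]. *)
have trS1 rho0 psi0 (S0 : 'M[C]_(e, d)) : M rho0 -> adj psi0 *m psi0 = 1%:M ->
    rho0 = coef_mx (W *m psi0) *m adj (coef_mx (W *m psi0)) ->
    V *m coef_mx (W *m psi0) = embl psi0 *m S0 -> \tr (adj S0 *m S0) = 1.
  move=> Mr0 psi01 er0 VA0; have [_ <-] := MD Mr0; rewrite [in RHS]er0.
  rewrite [in RHS]mxtrace_mulC -(iso_dot _ _ VV) VA0 iso_dot //.
  by rewrite embl_dot psi01 mxE eqxx.
(* The equality case of Cauchy-Schwarz, by expanding the squared norm into 1 - 1 - 1 + 1. *)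
have SS' : S - S' = 0.
  apply: frobenius_eq0; rewrite adjB mulmxBr !mulmxBl !linearB /= trSS'.
  rewrite (trS1 rho psi) // (trS1 rho' psi') //.
  by rewrite -[adj S' *m S]adjK mxtrace_adj adjM adjK trSS' conjC1 !subrr addr0.
by case: neq; rewrite es es' (subr0_eq SS').
Qed.

Lemma env_class_density sigma rho : env_class V W M sigma rho -> density sigma.
Proof.
move=> [Mr [psi [S [psi1 VA er ->]]]]; split; first exact: psd_gram.
have [_ <-] := MD Mr; rewrite [in RHS]er.
rewrite mxtrace_mulC [in RHS]mxtrace_mulC -(iso_dot _ _ VV) VA iso_dot //.
by rewrite embl_dot psi1 mxE eqxx.
Qed.

End EnvClass.

Lemma essentially_pure_empty n (Mi : 'M[C]_n -> Prop) :
  (forall rho, ~ Mi rho) -> essentially_pure Mi.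
Proof.
move=> Mi0; have d1 : density (1%:M : 'M[C]_1).
  split; last exact: mxtrace1.
  by have := psd_gram (1%:M : 'M[C]_1); rewrite adj_1 mulmx1.
exists 1%N, n, 1%N, 1%:M, 1%:M, 1%:M; split=> // [|rho /Mi0 //].
by split; rewrite adj_1 mulmx1.
Qed.

(* The dimension e = n * m of the environment makes n * (m * m) = m * e. *)
Lemma env_class_essentially_pure n m d (V : 'M[C]_(m * (n * m), n)) (W : 'M[C]_(n * d, m))
    (M : 'M[C]_n -> Prop) (sigma : 'M[C]_(n * m)) :
  adj V *m V = 1%:M -> (forall rho, M rho -> density rho) ->
  essentially_pure (env_class V W M sigma).
Proof.
move=> VV MD.
(* A member of the class certifies that [sigma] is a density, hence also that [m] is positive. *)
have [[rho0 cl0]|no] := classic (exists rho, env_class V W M sigma rho); last first.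
  by apply: essentially_pure_empty => rho cl; apply: no; exists rho.
have sigD := env_class_density VV MD cl0.
have m_gt0 : (0 < m * m)%N.
  by move: (density_dim sigD); rewrite !muln_gt0 => /andP [_ ->].
pose w : 'cV[C]_(m * m) := delta_mx (Ordinal m_gt0) 0.
have ww : adj w *m w = 1%:M.
  by apply: mx11_1; rewrite /w -colE !mxE !eqxx conjC1.
have RR : adj (embr w : 'M[C]_(n * _, n)) *m embr w = 1%:M.
  by rewrite embr_dot ww mxE eqxx.
(* [U] undoes [V] up to the ancilla: [U *m V] is the embedding that adjoins [w]. *)
have [|U [Uu UV]] := unitary_extension _ RR VV; first by rewrite mulnCA.
exists (m * m)%N, m, (n * m)%N, sigma, (w *m adj w), U; split=> //.
  by split; [exact: psd_gram | rewrite mxtrace_mulC ww mxtrace1].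
move=> rho [_ [psi [S [psi1 VA er es]]]]; exists psi; split; first by rewrite psi1 mxE.
have UVA : U *m V *m coef_mx (W *m psi) = U *m embl psi *m S.
  by rewrite -mulmxA VA mulmxA.
rewrite -embl_conj -embr_conj -UV es er.
(* Both sides are the Gram matrix of [U *m V] applied to the purification of [rho]. *)
transitivity ((U *m embl psi *m S) *m adj (U *m embl psi *m S)).
  by rewrite -UVA !adjM !mulmxA.
by rewrite !adjM !mulmxA.
Qed.

Lemma purifying_reversible_decomposition n m (M : 'M[C]_n -> Prop) (f : 'M[C]_n -> 'M[C]_m) :
  (forall rho, M rho -> density rho) ->
  CPTP f -> purifying_on f M -> reversible_on f M ->
  exists (I : Type) (Ms : I -> 'M[C]_n -> Prop),
      [/\ (forall rho, M rho <-> exists i, Ms i rho),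
          (forall i j, i <> j -> orth_sets (Ms i) (Ms j)) &
          (forall i, essentially_pure (Ms i))].
Proof.
move=> MD fP fpure [g [gP gf]].
have [V [VV fV]] := stinespring fP; have [W [WW gW]] := stinespring gP.
(* The index set is all environment matrices; classes without members are harmless. *)
exists _, (env_class V W M); split=> [rho|sigma sigma' neq|sigma].
- split=> [Mr|[sigma [//]]].
  have [psi [psi1 fr]] := pure_density (cptp_density fP (MD _ Mr)) (fpure _ Mr).
  set A := coef_mx (W *m psi).
  (* The marginal of [W *m psi] is [g (f rho)], which is [rho]. *)
  have er : rho = A *m adj A.
    by rewrite coef_mx_gram adjM mulmxA -(mulmxA W) -gW -fr gf.
  (* As [rho] is [A *m adj A], the marginal of the Gram matrix of [V *m A] is the pure state
     [f rho]. *)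
  have VA : V *m A = embl psi *m (adj (embl psi) *m (V *m A)).
    by apply: pure_marginal => //; rewrite adjM mulmxA -(mulmxA V) -er -fV.
  exists ((adj (embl psi) *m (V *m A)) *m adj (adj (embl psi) *m (V *m A))).
  by split=> //; exists psi, (adj (embl psi) *m (V *m A)).
- exact: env_class_orth.
- exact: env_class_essentially_pure.
Qed.

(** * From the decomposition to a purifying channel *)

(** With Gram factors A and B, the trace is the squared Frobenius norm of A^* B. *)
Lemma psd_orth n (rho sigma : 'M[C]_n) :
  psd rho -> psd sigma -> \tr (rho *m sigma) = 0 -> rho *m sigma = 0.
Proof.
move=> /psd_sqrt [A ->] /psd_sqrt [B ->] tr0.
suff AB : adj A *m B = 0 by rewrite -mulmxA (mulmxA (adj A)) AB mul0mx mulmx0.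
apply: frobenius_eq0; rewrite -{}tr0 -[RHS]mxtrace_mulC adjM adjK.
by rewrite -!mulmxA mxtrace_mulC -!mulmxA.
Qed.

(** Normalise a nonzero column. The form [X *m x] lets whatever annihilates [X] on the left
    annihilate the vector. *)
Lemma unit_vector_in_range m n (X : 'M[C]_(m, n)) : X <> 0 ->
  exists x : 'cV[C]_n, adj (X *m x) *m (X *m x) = 1%:M.
Proof.
move=> X0; have [j Xj] : exists j, X *m delta_mx j 0 != 0 :> 'cV_m.
  apply/existsP; apply: contra_notT X0 => /existsPn Xj.
  apply/matrixP=> i j; have /eqP := negbNE (Xj j).
  by rewrite -colE => /colP /(_ i); rewrite !mxE.
set u : 'cV_m := X *m _ in Xj; pose N := (adj u *m u) 0 0.
have N0 : 0 < N.
  rewrite lt_def /N -[(_ *m _) 0 0]trace_mx11 frobenius_ge0 andbT.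
  by apply: contra_neq Xj; exact: frobenius_eq0.
pose c := (sqrtC N)^-1.
have cN : Num.conj c * c * N = 1.
  rewrite geC0_conj ?invr_ge0 ?sqrtC_ge0 ?ltW // -expr2 exprVn sqrtCK.
  by rewrite mulVf // gt_eqF.
exists (c *: delta_mx j 0); apply: mx11_1.
rewrite -scalemxAr -/u -cN.
by rewrite adj_scale -scalemxAl -scalemxAr scalerA mxE.
Qed.

Lemma isometry_dim m n (B : 'M[C]_(m, n)) : adj B *m B = 1%:M -> (n <= m)%N.
Proof. exact: mulmx1_min. Qed.

(** An isometry with r + 1 columns forces r < n, so the truncated subtraction strictly decreases. *)
Lemma codim_row_mx n r d (B : 'M[C]_(n, r)) (w : 'cV[C]_n) :
  adj (row_mx B w) *m row_mx B w = 1%:M -> (n - r < d.+1)%N -> (n - (r + 1) < d)%N.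
Proof.
move=> /isometry_dim; rewrite addn1 ltnS => rn nrd.
by apply: leq_trans nrd; apply: ltn_sub2l.
Qed.

(** Greedy construction: while some state of [M1] is not fixed by B B^*, adjoin to the frame a unit
    vector from the residual of that state; the codimension bounds the number of rounds. *)
Lemma support_projector n (M1 M2 : 'M[C]_n -> Prop) :
  (forall rho, M1 rho -> psd rho) -> (forall rho, M2 rho -> psd rho) ->
  orth_sets M1 M2 ->
  exists P : 'M[C]_n,
    [/\ adj P = P, P *m P = P, forall rho, M1 rho -> P *m rho = rho &
        forall sigma, M2 sigma -> P *m sigma = 0].
Proof.
move=> M1p M2p M12.
suff main d r (B : 'M[C]_(n, r)) : (n - r < d)%N -> adj B *m B = 1%:M ->
    (forall sigma, M2 sigma -> adj B *m sigma = 0) ->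
  exists (r' : nat) (B' : 'M[C]_(n, r')),
    [/\ adj B' *m B' = 1%:M, forall rho, M1 rho -> B' *m (adj B' *m rho) = rho &
        forall sigma, M2 sigma -> adj B' *m sigma = 0].
  have [|||r [B [BB BM1 BM2]]] := main n.+1 0%N 0; first by rewrite subn0.
  - by apply/matrixP=> [[]].
  - by move=> sigma _; apply/matrixP=> [[]].
  exists (B *m adj B); split=> [||rho /BM1|sigma /BM2 B0].
  - by rewrite adjM adjK.
  - by rewrite mulmxA (isoKr _ BB).
  - by rewrite mulmxA.
  - by rewrite -mulmxA B0 mulmx0.
elim: d r B => [//|d IHd] r B nrd BB BM2.
have [[rho [M1r Br]]|none] :=
    classic (exists rho, M1 rho /\ B *m (adj B *m rho) <> rho); last first.
  by exists r, B; split=> // rho M1r; apply: NNPP => Br; case: none; exists rho.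
have /unit_vector_in_range [x] : rho - B *m (adj B *m rho) <> 0.
  by move/subr0_eq/esym.
set w := _ *m x => ww.
have Bw : adj B *m w = 0 by rewrite mulmxA mulmxBr (isoK _ BB) subrr mul0mx.
have Bww := isometry_row_mx BB ww Bw.
apply: (IHd _ (row_mx B w)) => [|//|]; first exact: codim_row_mx Bww nrd.
move=> sigma M2s; rewrite adj_row_mx mul_col_mx BM2 //.
(* The new vector stays orthogonal to [M2], because both [rho] and [adj B] annihilate [sigma]. *)
have rs := psd_orth (M1p _ M1r) (M2p _ M2s) (M12 _ _ M1r M2s).
have rh : adj rho = rho by have [] := M1p _ M1r.
rewrite /w adjM adjB !adjM adjK rh -mulmxA mulmxBl rs -!mulmxA BM2 //.
by rewrite !mulmx0 subrr mulmx0 col_mx0.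
Qed.

Definition purifiable n (M : 'M[C]_n -> Prop) : Prop :=
  exists (m : nat) (f : 'M[C]_n -> 'M[C]_m),
    [/\ CPTP f, purifying_on f M & reversible_on f M].

Lemma purifiable_sub n (M M' : 'M[C]_n -> Prop) :
  (forall rho, M' rho -> M rho) -> purifiable M -> purifiable M'.
Proof.
move=> sub [m [f [fP fpure [g [gP gf]]]]]; exists m, f; split=> //.
  by move=> rho /sub; apply: fpure.
by exists g; split=> // rho /sub; apply: gf.
Qed.

Lemma cptp_id n : CPTP (fun X : 'M[C]_n => X).
Proof.
split=> //; apply: cp_ext (@cp_conj _ _ 1%:M) => X.
by rewrite adj_1 mul1mx mulmx1.
Qed.

(** Undoing [U] and discarding B leaves the pure state; B always carries [sig], so preparing it
    afresh, applying [U] and discarding C restores [rho]. *)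
Lemma essentially_pure_purifiable n (M : 'M[C]_n -> Prop) :
  essentially_pure M -> purifiable M.
Proof.
move=> [c [a [b [sig [om [U [sigD omD [UU' U'U] MU]]]]]]].
have fP := @cptp_dilation n a b c (adj U) om; rewrite adjK in fP.
exists a, (fun X => ptr (adj U *m (X *t om) *m U)).
have fE rho (phi : 'cV[C]_a) : rho *t om = U *m ((phi *m adj phi) *t sig) *m adj U ->
    ptr (adj U *m (rho *t om) *m U) = phi *m adj phi.
  move=> ->; rewrite -(mulmxA U) (isoK _ U'U) -mulmxA U'U mulmx1 ptr_tens.
  by have [_ ->] := sigD; rewrite scale1r.
split; first exact: fP.
- move=> rho /MU [phi [/mx11_1 phi1 /fE ->]].
  by rewrite mulmxA (isoKr _ phi1) mxtrace_mulC phi1 mxtrace1.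
- exists (fun Y => ptr (U *m (Y *t sig) *m adj U)); split.
    exact: cptp_dilation.
  move=> rho /MU [phi [_ e]]; rewrite (fE _ _ e) -e ptr_tens.
  by have [_ ->] := omD; rewrite scale1r.
Qed.

(** Serves twice: for gluing, the K are complementary projectors and the J inclusions of summands;
    for recovery, the K are the adjoint inclusions and the J identities. *)
Lemma cptp_instrument n p1 p2 q1 q2 m (K1 : 'M[C]_(p1, n)) (K2 : 'M[C]_(p2, n))
    (J1 : 'M[C]_(m, q1)) (J2 : 'M[C]_(m, q2))
    (f1 : 'M[C]_p1 -> 'M[C]_q1) (f2 : 'M[C]_p2 -> 'M[C]_q2) :
  adj K1 *m K1 + adj K2 *m K2 = 1%:M ->
  adj J1 *m J1 = 1%:M -> adj J2 *m J2 = 1%:M -> CPTP f1 -> CPTP f2 ->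
  CPTP (fun X => J1 *m f1 (K1 *m X *m adj K1) *m adj J1 +
                 J2 *m f2 (K2 *m X *m adj K2) *m adj J2).
Proof.
move=> KK JJ1 JJ2 [f1L f1P f1T] [f2L f2P f2T]; split.
- have linear_branch p q (K : 'M[C]_(p, n)) (J : 'M[C]_(m, q)) f :
      linear_map f -> linear_map (fun X => J *m f (K *m X *m adj K) *m adj J).
    move=> fL x A B; rewrite mulmxDr mulmxDl -scalemxAr -scalemxAl fL.
    by rewrite mulmxDr mulmxDl -scalemxAr -scalemxAl.
  move=> x A B /=; rewrite (linear_branch _ _ K1 J1 _ f1L) (linear_branch _ _ K2 J2 _ f2L).
  by rewrite scalerDr addrACA.
- by apply: cpD; apply: cp_comp (cp_comp (@cp_conj _ _ _) _) (@cp_conj _ _ _).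
- move=> X; rewrite linearD /= !(mxtrace_mulC _ (adj _)) !mulmxA JJ1 JJ2 !mul1mx.
  by rewrite f1T f2T !(mxtrace_mulC _ (adj _)) !mulmxA -linearD -mulmxDl KK mul1mx.
Qed.

Lemma purifiable_union n (M1 M2 : 'M[C]_n -> Prop) :
  (forall rho, M1 rho -> psd rho) -> (forall rho, M2 rho -> psd rho) ->
  orth_sets M1 M2 -> purifiable M1 -> purifiable M2 ->
  purifiable (fun rho => M1 rho \/ M2 rho).
Proof.
move=> M1p M2p M12 [m1 [f1 [f1P f1pure [g1 [g1P gf1]]]]] [m2 [f2 [f2P f2pure [g2 [g2P gf2]]]]].
have [P [Ph PP PM1 PM2]] := support_projector M1p M2p M12.
pose Q := 1%:M - P; have Qh : adj Q = Q by rewrite adjB adj_1 Ph.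
have PQ1 : adj P *m P + adj Q *m Q = 1%:M.
  rewrite Ph Qh PP mulmxBr mulmxBl mulmx1 mulmxBl PP !mul1mx subrr subr0.
  by rewrite mulmx1 addrC subrK.
have rh A : psd A -> adj A = A by case.
have rP rho : M1 rho -> rho *m P = rho.
  by move=> Mr; rewrite -[LHS]adjK adjM Ph (rh _ _ (M1p _ Mr)) PM1 // rh //; apply: M1p.
pose J1 : 'M[C]_(m1 + m2, m1) := col_mx 1%:M 0.
pose J2 : 'M[C]_(m1 + m2, m2) := col_mx 0 1%:M.
have J1E : adj J1 = row_mx 1%:M 0 by rewrite adj_col_mx adj_1 adj0.
have J2E : adj J2 = row_mx 0 1%:M by rewrite adj_col_mx adj_1 adj0.
have J11 : adj J1 *m J1 = 1%:M by rewrite J1E mul_row_col mul1mx mul0mx addr0.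
have J22 : adj J2 *m J2 = 1%:M by rewrite J2E mul_row_col mul1mx mul0mx add0r.
have J12 : adj J1 *m J2 = 0 by rewrite J1E mul_row_col mulmx0 mul0mx addr0.
have J21 : adj J2 *m J1 = 0 by rewrite J2E mul_row_col mulmx0 mul0mx addr0.
have JJ : adj (adj J1) *m adj J1 + adj (adj J2) *m adj J2 = 1%:M.
  rewrite !adjK J1E J2E !mul_col_row !mul1mx !mul0mx add_block_mx.
  by rewrite !addr0 !add0r -scalar_mx_block.
pose f X := J1 *m f1 (P *m X *m adj P) *m adj J1 + J2 *m f2 (Q *m X *m adj Q) *m adj J2.
(* The outcome [P] is certain on [M1] and leaves the state undisturbed; [Q] plays this part on
   [M2]. *)
have fM1 rho : M1 rho -> f rho = J1 *m f1 rho *m adj J1.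
  move=> Mr; have [f2L _ _] := f2P.
  have -> : f rho = J1 *m f1 (P *m rho *m P) *m adj J1 +
                    J2 *m f2 (Q *m rho *m Q) *m adj J2 by rewrite /f Ph Qh.
  rewrite mulmxBl mul1mx PM1 // subrr mul0mx linear_map0 // mulmx0 mul0mx addr0.
  by rewrite rP.
have fM2 rho : M2 rho -> f rho = J2 *m f2 rho *m adj J2.
  move=> Mr; have [f1L _ _] := f1P.
  have -> : f rho = J1 *m f1 (P *m rho *m P) *m adj J1 +
                    J2 *m f2 (Q *m rho *m Q) *m adj J2 by rewrite /f Ph Qh.
  rewrite mulmxBl mul1mx PM2 // subr0 mul0mx linear_map0 // mulmx0 mul0mx add0r.
  suff -> : rho *m Q = rho by [].
  by rewrite -[LHS]adjK adjM Qh (rh _ _ (M2p _ Mr)) mulmxBl mul1mx PM2 // subr0 rh //; apply: M2p.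
exists (m1 + m2)%N, f; split; first exact: cptp_instrument.
- have pure_branch q (J : 'M[C]_(m1 + m2, q)) Y : adj J *m J = 1%:M ->
      \tr (J *m Y *m adj J *m (J *m Y *m adj J)) = \tr (Y *m Y).
    by move=> Jiso; rewrite mxtrace_mulC !mulmxA (isoKr _ Jiso) mxtrace_mulC !mulmxA Jiso mul1mx.
  move=> rho [Mr|Mr]; first by rewrite (fM1 _ Mr) pure_branch //; apply: f1pure.
  by rewrite (fM2 _ Mr) pure_branch //; apply: f2pure.
(* Recovery measures the summand, then applies its reversing channel; the identity factors fit the
   instrument form. *)
exists (fun Y => 1%:M *m g1 (adj J1 *m Y *m adj (adj J1)) *m adj 1%:M +
                 1%:M *m g2 (adj J2 *m Y *m adj (adj J2)) *m adj 1%:M); split.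
  by apply: cptp_instrument => //; rewrite adj_1 mulmx1.
have [g1L _ _] := g1P; have [g2L _ _] := g2P.
move=> rho [Mr|Mr]; rewrite !adjK !adj_1 !mulmx1 !mul1mx.
- rewrite (fM1 _ Mr) !mulmxA J11 J21 mul1mx !mul0mx (linear_map0 g2L) addr0 -mulmxA J11 mulmx1.
  exact: gf1.
- rewrite (fM2 _ Mr) !mulmxA J22 J12 mul1mx !mul0mx (linear_map0 g1L) add0r -mulmxA J22 mulmx1.
  exact: gf2.
Qed.

(* Induction on the codimension of a frame B orthogonal to all the states; splitting
   off one nonempty member of the family provides a further vector for B. *)
Lemma purifiable_orthogonal_family n (I : Type) d r (B : 'M[C]_(n, r))
    (Ms : I -> 'M[C]_n -> Prop) :
  (n - r < d)%N -> adj B *m B = 1%:M ->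
  (forall i rho, Ms i rho -> density rho /\ adj B *m rho = 0) ->
  (forall i j, i <> j -> orth_sets (Ms i) (Ms j)) ->
  (forall i, purifiable (Ms i)) ->
  purifiable (fun rho => exists i, Ms i rho).
Proof.
elim: d r B Ms => [//|d IHd] r B Ms nrd BB MsD Morth Mpure.
(* If every set is empty, the identity channel works vacuously. *)
have [[i [rho Mr]]|none] := classic (exists i rho, Ms i rho); last first.
  exists n, id; split; [exact: cptp_id | | exists id; split; first exact: cptp_id];
  by move=> rho [i Mr]; case: none; exists i, rho.
have [rhoD Br] := MsD _ _ Mr.
have /unit_vector_in_range [x] : rho <> 0.
  by move=> rho0; have [_ /eqP] := rhoD; rewrite rho0 linear0 eq_sym oner_eq0.
set w := _ *m x => ww.
have Bw : adj B *m w = 0 by rewrite mulmxA Br mul0mx.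
have Bww := isometry_row_mx BB ww Bw.
(* Emptying the set at [i] keeps the index type for the induction. *)
pose Ms' j sigma := j <> i /\ Ms j sigma.
have rest : purifiable (fun sigma => exists j, Ms' j sigma).
  apply: (IHd _ (row_mx B w)) => //; first exact: codim_row_mx Bww nrd.
  - move=> j sigma [ji Mj]; have [sigD Bs] := MsD _ _ Mj; split=> //.
    (* The other sets are annihilated by [rho], hence by the adjoint of [w]. *)
    rewrite adj_row_mx mul_col_mx Bs adjM; have [[rh _] _] := rhoD; rewrite -rh.
    rewrite -mulmxA psd_orth ?mulmx0 ?col_mx0 //; [by case: rhoD | by case: sigD|].
    by apply: Morth Mr Mj => ij; apply: ji.
  - by move=> j k jk s t [_ Ms1] [_ Mt]; apply: Morth Ms1 Mt.
  - by move=> j; apply: purifiable_sub (Mpure j) => s [].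
have union : purifiable (fun sigma => Ms i sigma \/ exists j, Ms' j sigma).
  apply: purifiable_union => //.
  - by move=> s /MsD [[]].
  - by move=> s [j [_ /MsD [[]]]].
  - by move=> s t Mis [j [ji Mt]]; apply: Morth Mis Mt => ij; apply: ji.
apply: purifiable_sub union => s [j Mj].
by have [ji|ji] := classic (j = i); [left; rewrite -ji | right; exists j].
Qed.

Theorem theorem1 (n : nat) (M : 'M[C]_n -> Prop)
  (HM : forall rho, M rho -> density rho) :
  (exists (m : nat) (f : 'M[C]_n -> 'M[C]_m),
      [/\ CPTP f, purifying_on f M & reversible_on f M]) <->
  (exists (I : Type) (Ms : I -> 'M[C]_n -> Prop),
      [/\ (forall rho, M rho <-> exists i, Ms i rho),
          (forall i j, i <> j -> orth_sets (Ms i) (Ms j)) &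
          (forall i, essentially_pure (Ms i))]).
Proof.
split=> [[m [f [fP fpure frev]]]|[I [Ms [MMs Morth Mpure]]]].
  exact: purifying_reversible_decomposition fP fpure frev.
suff : purifiable (fun rho => exists i, Ms i rho).
  by apply: purifiable_sub => rho /MMs.
(* Start from the empty frame, of codimension n. *)
apply: (@purifiable_orthogonal_family n I n.+1 0%N 0) => //.
- by rewrite subn0.
- by apply/matrixP=> [[]].
- move=> i rho Mr; split; last by apply/matrixP=> [[]].
  by apply: HM; apply/MMs; exists i.
- by move=> i; exact: essentially_pure_purifiable.
Qed.
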